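(* Let $\gamma>0$, let $\tau:=1/\gamma$, and suppose that $(z^j)_{j\ge0}$ is generated by the FDRS iteration with $\lambda_k\equiv1$, i.e. $z^{k+1}=Tz^k$ with $z^0\in\mathcal H$. For all $k\ge0$, let $y^k:=-\widetilde\nabla\chi_V(x_h^k)$, where $\widetilde\nabla\chi_V(x_h^k):=\frac1\gamma P_{V^\perp}z^k$. Then for all $k\ge0$ we have the recursive update rule $$\begin{cases}y^{k+1}=P_{V^\perp}(y^k-\tau x_f^k);\\ x_f^{k+1}=\mathrm{prox}_{\gamma f}\left(x_f^k-\gamma\nabla h(x_f^k)+\gamma(2y^{k+1}-y^k)\right).\end{cases}$$
   Context: $\mathcal H$ is a real Hilbert space with identity map $I$; $V\subseteq\mathcal H$ is a closed vector subspace; $P_V,P_{V^\perp}$ are the orthogonal projections onto $V$ and $V^\perp$; $\chi_V$ is the indicator function of $V$ ($0$ on $V$, $+\infty$ elsewhere), so $\partial\chi_V(x)=V^\perp$ for $x\in V$ and $\emptyset$ otherwise. Standing assumptions: $f,g:\mathcal H\to(-\infty,\infty]$ are closed, proper and convex; $g$ is differentiable on $\mathcal H$ and $\nabla g$ is $(1/\beta)$-Lipschitz, $\beta>0$; $h:=g\circ P_V$, so $\nabla h=P_V\circ\nabla g\circ P_V$, and $\beta_V>0$ is such that $\nabla h$ is $(1/\beta_V)$-Lipschitz; there exists $x$ with $0\in\partial f(x)+\nabla g(x)+\partial\chi_V(x)$. For $\gamma>0$: $\mathrm{prox}_{\gamma f}(x):=\arg\min_{y}\left(f(y)+\frac1{2\gamma}\|y-x\|^2\right)$,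 $\mathrm{refl}_{\gamma f}:=2\,\mathrm{prox}_{\gamma f}-I$, $\mathrm{refl}_{\chi_V}:=2P_V-I$. The FDRS operator is $T:=\left(\frac12I+\frac12\mathrm{refl}_{\gamma f}\circ\mathrm{refl}_{\chi_V}\right)\circ(I-\gamma\nabla h)$. For each $k$: $x_h^k:=P_Vz^k$ and $x_f^k:=\mathrm{prox}_{\gamma f}\big(\mathrm{refl}_{\chi_V}(z^k-\gamma\nabla h(z^k))\big)$. *)

(* Defs.v *)
From HB Require Import structures.
From mathcomp Require Import all_boot all_order all_algebra.
From mathcomp Require Import all_classical all_reals all_analysis.

Set Implicit Arguments.
Unset Strict Implicit.
Unset Printing Implicit Defensive.

Import Order.TTheory GRing.Theory Num.Theory.
Import numFieldNormedType.Exports.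

Local Open Scope classical_set_scope.
Local Open Scope ring_scope.

(** A real Hilbert space is a complete normed module [H] over a [realType],
    together with a symmetric positive definite form inducing its norm. *)
Definition induces_norm (R : realType) (H : completeNormedModType R)
    (dot : {dot H for @idfun R}) : Prop :=
  forall x : H, dot x x = `|x| ^+ 2.

Section Hilbert.
Context {R : realType} {H : completeNormedModType R}.
Variable dot : {dot H for @idfun R}.
Implicit Types (V : set H) (f : H -> \bar R) (x y u v : H).

Definition closed_subspace V : Prop :=
  [/\ V 0, forall (a : R) x y, V x -> V y -> V (a *: x + y) & closed V].

Definition orthogonal_complement V : set H :=
  [set y | forall v, V v -> dot y v = 0].

(** [xget] selects the projection, which exists and is unique when [V] is a
    closed subspace; the default value [0] is then irrelevant. The same
    encoding is used for [gradient] and [prox] below. *)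
Definition orth_proj V x : H :=
  xget 0 [set p | V p /\ orthogonal_complement V (x - p)].

Definition chi V x : \bar R := if x \in V then 0%E else +oo%E.

(** The value [-oo] is excluded as functions range over (-oo, +oo]. *)
Definition proper_fun f : Prop :=
  (forall x, f x != -oo%E) /\ (exists x, f x != +oo%E).

Definition epigraph f : set (H * R) := [set p | (f p.1 <= (p.2)%:E)%E].

Definition closed_fun f : Prop := closed (epigraph f).

Definition convex_fun f : Prop :=
  forall x y (t : R), 0 <= t <= 1 ->
    (f (t *: x + (1 - t) *: y)%R <= t%:E * f x + (1 - t)%:E * f y)%E.

Definition closed_proper_convex f : Prop :=
  [/\ closed_fun f, proper_fun f & convex_fun f].

Definition subdiff f x : set H :=
  [set u | forall y, (f x + (dot u (y - x)%R)%:E <= f y)%E].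

(** Differentiability on the whole space (in the Frechet sense) forces [f] to
    be finite everywhere, so that [fine \o f] loses no information. *)
Definition differentiable_everywhere f : Prop :=
  forall x, f x \is a fin_num /\ differentiable (fine \o f) x.

Definition is_gradient f x u : Prop :=
  differentiable (fine \o f) x /\
  forall v, 'd (fine \o f) x v = dot u v.

Definition gradient f x : H := xget 0 (is_gradient f x).

Definition argmin (F : H -> \bar R) : set H :=
  [set y | forall y', (F y <= F y')%E].

Definition prox (gamma : R) f x : H :=
  xget 0 (argmin (fun y => f y + ((2 * gamma)^-1 * `|y - x| ^+ 2)%:E)%E).

Definition refl_prox (gamma : R) f x : H := 2 *: prox gamma f x - x.

Definition refl_chi V x : H := 2 *: orth_proj V x - x.

(** [gradh] stands for the gradient of the smooth term. *)
Definition FDRS (gamma : R) f V (gradh : H -> H) : H -> H :=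
  (fun x => 2^-1 *: x + 2^-1 *: refl_prox gamma f (refl_chi V x))
  \o (fun x => x - gamma *: gradh x).

End Hilbert.

(* Main.v *)
Require Import Defs.
From HB Require Import structures.
From mathcomp Require Import all_boot all_order all_algebra.
From mathcomp Require Import all_classical all_reals all_analysis.
From mathcomp Require Import ring lra.

Import Order.TTheory GRing.Theory Num.Theory.
Import numFieldNormedType.Exports.

Local Open Scope classical_set_scope.
Local Open Scope ring_scope.

(** Write [P] for the projection onto [V], [Q = I - P] for the projection onto
    its orthogonal complement, [G] for the gradient of [h = g \o P] and
    [p = xf k].  Two facts about [G] carry the proof: its values lie in [V], and
    [G u] depends only on [P u].  Both hold because [h] is invariant under
    translation by vectors orthogonal to [V] ([gradient_orth] and
    [gradient_shift]).

    Since [P (G u) = G u], expanding the reflections in the FDRS operator gives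
    [z k.+1 = p + Q (z k)].  Applying [Q] and scaling by [- gamma^-1] is the
    update of [y]; applying [P] gives [P (z k.+1) = P p], hence
    [G (z k.+1) = G p].  The point at which [prox] is evaluated to get
    [xf k.+1] is therefore
    [2 P p - z k.+1 - gamma G p = p - gamma G p - 2 Q (z k.+1) + Q (z k)],
    and [- 2 Q (z k.+1) + Q (z k) = gamma (2 y k.+1 - y k)].

    These computations need [P] to be linear, idempotent and complementary to
    [Q].  All of this follows from the projection theorem ([orth_proj_exists])
    and from uniqueness ([orth_proj_eq]): a minimizing family in [V] is Cauchy
    by the parallelogram law, and the first-order condition at a nearest point
    is orthogonality. *)

Section OrthogonalProjection.
Set Implicit Arguments.
Unset Strict Implicit.
Context {R : realType} {H : completeNormedModType R}.
Context (dot : {dot H for @idfun R}) (hdot : induces_norm dot).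
Implicit Types (V : set H) (u v w x y p : H).

Lemma dotC u v : dot u v = dot v u.
Proof. by rewrite hermC expr0 mul1r. Qed.

Lemma dotZl a u v : dot (a *: u) v = a * dot u v.
Proof. exact: linearZl_LR. Qed.

Lemma dotZr a u v : dot u (a *: v) = a * dot u v.
Proof. by rewrite dotC dotZl dotC. Qed.

Lemma dotDl u v w : dot (u + v) w = dot u w + dot v w.
Proof. exact: linearDl. Qed.

Lemma dotDr u v w : dot w (u + v) = dot w u + dot w v.
Proof. exact: linearDr. Qed.

Lemma dotNl u v : dot (- u) v = - dot u v.
Proof. exact: linearNl. Qed.

Lemma dotNr u v : dot v (- u) = - dot v u.
Proof. exact: linearNr. Qed.

Definition dotE := (dotZl, dotZr, dotDl, dotDr, dotNl, dotNr).

(** Pairing with an arbitrary [w] turns an identity between linear combinations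
    of vectors into a scalar one, which [lra] and [field] decide. *)
Lemma dot_separates u v : (forall w, dot u w = dot v w) -> u = v.
Proof.
move=> e; apply/eqP; rewrite -subr_eq0 -normr_eq0 -sqrf_eq0 -hdot.
by rewrite !dotE !e; apply/eqP; ring.
Qed.

(** Uniqueness of a projection is purely algebraic.  Isolating the algebraic
    part of a closed subspace lets it apply to the orthogonal complement of [V],
    onto which the projection is computed explicitly as [x - P x]. *)
Definition subspace V :=
  V 0 /\ forall (a : R) x y, V x -> V y -> V (a *: x + y).

Lemma closed_subspaceW V : closed_subspace V -> subspace V.
Proof. by case. Qed.

Lemma subspaceB V x y : subspace V -> V x -> V y -> V (x - y).
Proof. by move=> [_ h] Vx Vy; rewrite addrC -scaleN1r; apply: h. Qed.

Lemma orth_subspace V : subspace (orthogonal_complement dot V).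
Proof.
split=> [v _|a x y hx hy v Vv]; first by rewrite linear0l.
by rewrite !dotE hx// hy// mulr0 addr0.
Qed.

(** The difference of two candidates lies both in [V] and in its orthogonal
    complement, so it is zero. *)
Lemma orth_proj_eq V x p :
  subspace V -> V p -> orthogonal_complement dot V (x - p) ->
  orth_proj dot V x = p.
Proof.
move=> sV Vp op; apply: xget_unique => // q [Vq oq].
have Vd : V (q - p) by exact: subspaceB.
apply/eqP; rewrite -subr_eq0 -normr_eq0 -sqrf_eq0 -hdot.
have := oq _ Vd; have := op _ Vd; rewrite !dotE => e1 e2.
by apply/eqP; lra.
Qed.

(** The parallelogram law for [w - u] and [w - v]. *)
Lemma apollonius u v w :
  `|u - v| ^+ 2 + 4 * `|w - (2^-1 *: v + 2^-1 *: u)| ^+ 2 =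
  2 * `|w - u| ^+ 2 + 2 * `|w - v| ^+ 2.
Proof. by rewrite -!hdot !dotE (dotC u w) (dotC v w) (dotC v u); lra. Qed.

(** The points of [V] that are nearly nearest to [x] generate a filter.  The
    midpoint of two of them is in [V], hence no closer to [x] than the infimum,
    so the parallelogram law makes the filter Cauchy; its limit is nearest. *)
Lemma nearest_point V x : closed_subspace V ->
  exists2 p, V p & forall v, V v -> `|x - p| ^+ 2 <= `|x - v| ^+ 2.
Proof.
move=> [V0 Vlin Vcl].
pose D := [set `|x - v| ^+ 2 | v in V].
have hD : has_inf D.
  split; first by exists (`|x - 0| ^+ 2); exists 0.
  by exists 0 => _ [v _ <-]; rewrite exprn_ge0.
pose A e := [set v | V v /\ `|x - v| ^+ 2 < inf D + e].
pose F := filter_from [set e : R | 0 < e] A.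
have FF : ProperFilter F.
  apply: filter_from_proper.
    apply: filter_from_filter; first by exists 1 => /=.
    move=> e d /= e0 d0; exists (Num.min e d); first by rewrite /= lt_min e0.
    move=> v [Vv]; rewrite -ltrBlDl lt_min => /andP[h1 h2].
    by split; split=> //; rewrite -ltrBlDl.
  by move=> e /= e0; have [_ [v Vv <-] h] := inf_adherent e0 hD; exists v.
have infD v : V v -> inf D <= `|x - v| ^+ 2.
  by move=> Vv; apply: ge_inf; [exact: hD.2|exists v].
have /cauchy_cvgP/cvg_ex[p Fp] : cauchy F.
  apply: cauchy_exP => e e0.
  (* two points of [A d] satisfy [`|p - q| ^+ 2 < 4 * d] *)
  have e4 : 0 < e ^+ 2 / 4 by rewrite divr_gt0 ?exprn_gt0.
  have [_ [p Vp <-] hp] := inf_adherent e4 hD.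
  exists p; exists (e ^+ 2 / 4) => // q [Vq hq].
  rewrite -ball_normE /ball_ /=.
  rewrite -(@ltr_pXn2r _ 2) ?nnegrE//; last exact: ltW.
  have Vm : V (2^-1 *: q + 2^-1 *: p).
    by apply: (Vlin) => //; rewrite -[_ *: p]addr0; exact: Vlin.
  by have := infD _ Vm; have := apollonius p q x; lra.
have Vp : V p.
  by apply: (@closed_cvg _ _ F FF id V Vcl _ p Fp); exists 1 => //= v [].
exists p => // v Vv; apply: le_trans (infD _ Vv).
apply/ler_addgt0Pl => e e0.
have cvx : `|x - v| ^+ 2 @[v --> F] --> `|x - p| ^+ 2.
  rewrite expr2; under eq_fun do rewrite expr2.
  by apply: cvgM; apply: cvg_norm; apply: cvgB => //; apply: cvg_cst.
suff nA : \forall v \near F, `|x - v| ^+ 2 <= e + inf D.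
  exact: (closed_cvg _ (@closed_le R (e + inf D)) nA _ cvx).
by exists e => // w [_ hw]; rewrite (addrC e) ltW.
Qed.

Lemma orth_of_minimal u v :
  (forall a : R, `|u| ^+ 2 <= `|u - a *: v| ^+ 2) -> dot u v = 0.
Proof.
move=> hmin; have [->|v0] := eqVneq v 0; first by rewrite linear0r.
have N0 : 0 < dot v v by rewrite hdot exprn_gt0// normr_gt0.
(* this [a] minimizes the quadratic [a |-> `|u - a *: v| ^+ 2] *)
have := hmin (dot u v / dot v v); rewrite -!hdot !dotE (dotC v u).
set s := dot u v; set N := dot v v in N0 *.
rewrite [leRHS](_ : _ = dot u u - s ^+ 2 / N); last by field; rewrite gt_eqF.
rewrite lerDl oppr_ge0 pmulr_lle0 ?invr_gt0// => h.
by apply/eqP; rewrite -sqrf_eq0 eq_le h sqr_ge0.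
Qed.

Lemma orth_proj_exists V x : closed_subspace V ->
  exists2 p, V p & orthogonal_complement dot V (x - p).
Proof.
move=> cV; have [p Vp hp] := nearest_point x cV.
have [_ Vlin _] := cV.
exists p => // v Vv; apply: orth_of_minimal => a.
by rewrite -addrA -opprD (addrC p); exact/hp/Vlin.
Qed.

Section ClosedSubspace.
Context (V : set H) (hV : closed_subspace V).

Local Notation P := (orth_proj dot V).
Local Notation Vorth := (orthogonal_complement dot V).
Let sV := closed_subspaceW hV.

Lemma orth_projP x : V (P x) /\ Vorth (x - P x).
Proof.
have [p Vp op] := orth_proj_exists x hV.
by rewrite (orth_proj_eq sV Vp op).
Qed.

Lemma orth_proj_lin a x y : P (a *: x + y) = a *: P x + P y.
Proof.
have [[Vx ox] [Vy oy]] := (orth_projP x, orth_projP y).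
apply: (orth_proj_eq sV); first exact: sV.2.
have -> : a *: x + y - (a *: P x + P y) = a *: (x - P x) + (y - P y).
  by rewrite scalerBr opprD addrACA.
exact: (orth_subspace V).2.
Qed.

Lemma orth_proj_id x : V x -> P x = x.
Proof.
move=> Vx; apply: (orth_proj_eq sV) => //.
by rewrite subrr; exact: (orth_subspace V).1.
Qed.

Lemma orth_proj_orth0 x : Vorth x -> P x = 0.
Proof.
by move=> ox; apply: (orth_proj_eq sV); [exact: sV.1 | rewrite subr0].
Qed.

(** For [x] orthogonal to [Vorth], the vector [x - P x] is orthogonal both to
    [x] and to [P x], hence to itself. *)
Lemma orth_orth x : orthogonal_complement dot Vorth x -> V x.
Proof.
move=> ox; have [Vx oPx] := orth_projP x.
suff -> : x = P x by [].
apply/eqP; rewrite -subr_eq0 -normr_eq0 -sqrf_eq0 -hdot linearBl/= ox//.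
by rewrite dotC oPx// subr0.
Qed.

Lemma orth_proj_compl x : orth_proj dot Vorth x = x - P x.
Proof.
have [Vx ox] := orth_projP x.
apply: (orth_proj_eq (orth_subspace V)) => // u ou.
by rewrite subKr dotC ou.
Qed.

End ClosedSubspace.
End OrthogonalProjection.

Section GradientInvariance.
Set Implicit Arguments.
Unset Strict Implicit.
Context {R : realType} {H : completeNormedModType R}.
Context (dot : {dot H for @idfun R}).
Implicit Types (f : H -> \bar R) (c u x : H).

Lemma is_gradient_shift f c x u : (forall y, f (y + c) = f y) ->
  is_gradient dot f (x + c) u -> is_gradient dot f x u.
Proof.
move=> fc [df gf].
have e : fine \o f = (fine \o f) \o (fun y => y + c).
  by apply/funext => y /=; rewrite fc.
have ds : is_diff x (fun y : H => y + c) id.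
  by have := is_diffD (is_diff_id x) (is_diff_cst c x); rewrite addr0.
split; first by rewrite e; exact: differentiable_comp.
by move=> v; rewrite e diff_comp//= (@diff_val _ _ _ _ _ _ _ ds) gf.
Qed.

(** The sets of gradients at the two points coincide, and so do the elements
    that [xget] selects from them, also when these sets are empty. *)
Lemma gradient_shift f c x : (forall y, f (y + c) = f y) ->
  gradient dot f (x + c) = gradient dot f x.
Proof.
move=> fc; rewrite /gradient; congr (xget _ _); apply/seteqP; split=> u.
  exact: is_gradient_shift.
rewrite -{1}[x](addrK c); apply: is_gradient_shift => y.
by rewrite -fc subrK.
Qed.

(** The pairing of the gradient with a direction is a directional derivative,
    and [f] is constant along the directions in [W]; at a point without a
    gradient, the default value [0] is orthogonal to [W] as well. *)
Lemma gradient_orth f (W : set H) x :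
  (forall y v (a : R), W v -> f (a *: v + y) = f y) ->
  orthogonal_complement dot W (gradient dot f x).
Proof.
move=> fW v Wv; rewrite /gradient.
case: xgetP => [u _ [df <-]|]; last by rewrite linear0l.
rewrite -deriveE// /derive.
apply: cvg_lim => //; apply: cvg_near_cst; near=> t => /=.
by rewrite fW// subrr scaler0.
Unshelve. all: by end_near. Qed.

End GradientInvariance.

Theorem lemma7p1 (R : realType) (H : completeNormedModType R)
  (dot : {dot H for @idfun R}) (hdot : induces_norm dot)
  (V : set H) (hV : closed_subspace V)
  (f g : H -> \bar R)
  (hf : closed_proper_convex f) (hg : closed_proper_convex g)
  (hdg : differentiable_everywhere g)
  (beta : R) (hbeta : 0 < beta)
  (hLg : (beta^-1).-lipschitz (gradient dot g))
  (h : H -> \bar R) (hh : h = g \o orth_proj dot V)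
  (betaV : R) (hbetaV : 0 < betaV)
  (hLh : (betaV^-1).-lipschitz (gradient dot h))
  (hsol : exists x u v : H, [/\ subdiff dot f x u, subdiff dot (chi V) x v
                              & 0 = u + gradient dot g x + v])
  (gamma : R) (hgamma : 0 < gamma)
  (tau : R) (htau : tau = gamma^-1)
  (z : nat -> H)
  (hz : forall k, z k.+1 = FDRS dot gamma f V (gradient dot h) (z k))
  (xf : nat -> H)
  (hxf : forall k, xf k =
    prox gamma f (refl_chi dot V (z k - gamma *: gradient dot h (z k))))
  (subgrad_chi : nat -> H)
  (hsubgrad_chi : forall k,
    subgrad_chi k = gamma^-1 *: orth_proj dot (orthogonal_complement dot V) (z k))
  (y : nat -> H) (hy : forall k, y k = - subgrad_chi k) :
  forall k,
    y k.+1 = orth_proj dot (orthogonal_complement dot V) (y k - tau *: xf k) /\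
    xf k.+1 = prox gamma f (xf k - gamma *: gradient dot h (xf k)
                            + gamma *: (2 *: y k.+1 - y k)).
Proof.
pose P := orth_proj dot V; pose G := gradient dot h.
have P_lin a u v : P (a *: u + v) = a *: P u + P v by exact: orth_proj_lin.
have PD u v : P (u + v) = P u + P v by rewrite -[u]scale1r P_lin !scale1r.
have P0 : P 0 = 0 by apply: orth_proj_id => //; have [] := hV.
have PZ a u : P (a *: u) = a *: P u by rewrite -[a *: u]addr0 P_lin P0 addr0.
have PN u : P (- u) = - P u by rewrite -scaleN1r PZ scaleN1r.
have PP u : P (P u) = P u.
  by apply: orth_proj_id => //; case: (orth_projP hdot hV u).
have QE u : orth_proj dot (orthogonal_complement dot V) u = u - P u.
  exact: orth_proj_compl.
have PG u : P (G u) = G u.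
  apply: orth_proj_id => //; apply: orth_orth => //.
  apply: gradient_orth => w v a ov.
  by rewrite hh /= orth_proj_lin// (orth_proj_orth0 hdot hV ov) scaler0 add0r.
have G_eq u v : P u = P v -> G u = G v.
  (* [v] is the translate of [u] by [v - u], and [P (v - u) = 0] *)
  move=> e; rewrite -[v](subrK u) addrC; symmetry; apply: gradient_shift => w.
  by rewrite hh /= -/P PD PD PN e subrr addr0.
have yE k : y k = - (gamma^-1 *: (z k - P (z k))) by rewrite hy hsubgrad_chi QE.
have zS k : z k.+1 = xf k + (z k - P (z k)).
  rewrite hz /FDRS /= -/G /refl_prox -hxf /refl_chi -/P PD PN PZ PG.
  by apply: (dot_separates hdot) => w; rewrite !(dotE dot); lra.
move=> k; have PzS : P (z k.+1) = P (xf k) by rewrite zS PD PD PN PP subrr addr0.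
split.
  rewrite QE !yE PzS zS htau !(PD, PN, PZ) PP.
  by apply: (dot_separates hdot) => w; rewrite !(dotE dot); lra.
rewrite hxf -/G (G_eq _ _ PzS) /refl_chi -/P; congr prox.
rewrite !yE PzS zS !(PD, PN, PZ) PP PG.
apply: (dot_separates hdot) => w; rewrite !(dotE dot); field.
by rewrite gt_eqF.
Qed.
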